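(* Let $q$ be a power of a prime $p$, $K$ an algebraic closure of $\mathbb{F}_q$, and let $\Delta_q$ be the stabilizer in $\mathrm{PGL}(3,q)$ of the triangle with vertices $(1:0:0),(0:1:0),(0:0:1)$, acting on $\mathrm{PG}(2,K)$. Then $d(\Delta_q)=q-1$, $\varepsilon(\Delta_q)=q-1$, and the Fermat curve $X^{q-1}+Y^{q-1}+Z^{q-1}=0$ is the only $\Delta_q$-invariant curve of degree $q-1$. Moreover, the $\Delta_q$-invariant irreducible plane curves of degree $2(q-1)$ are those of homogeneous equation $$\lambda(X^{q-1}+Y^{q-1}+Z^{q-1})^2+(XY)^{q-1}+(YZ)^{q-1}+(ZX)^{q-1}=0,\quad \lambda\in K.$$
   Context: Plane curves are over $K$; irreducible means irreducible over $K$; $G$-invariant means mapped onto itself by every element of $G$. $d(G)$ is the smallest degree of a $G$-invariant irreducible plane curve other than a line; $\varepsilon(G)=d'(G)-d(G)$ where $d'(G)$ is the smallest degree larger than $d(G)$ of a $G$-invariant irreducible plane curve.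
   Formalization: Assumes q > 2 (for q = 2 the Fermat curve is a line, so d = q-1 fails); uniqueness in degree q-1 is among irreducible curves (XYZ = 0 is invariant for q = 4); in degree 2(q-1) only irreducible members of the family are meant (λ = -1/3 is reducible if p ≠ 3). *)

(* Defs.v *)
From HB Require Import structures.
From mathcomp Require Import all_boot all_order all_algebra.
From mathcomp Require Import mpoly.
Set Implicit Arguments. Unset Strict Implicit. Unset Printing Implicit Defensive.
Import Order.TTheory GRing.Theory.
Local Open Scope ring_scope.

Section PlaneCurves.
Variable K : fieldType.

Definition x0 : 'I_3 := @Ordinal 3 0 isT.
Definition x1 : 'I_3 := @Ordinal 3 1 isT.
Definition x2 : 'I_3 := @Ordinal 3 2 isT.

(* A plane curve of degree n is given by a nonzero homogeneous F in K[X,Y,Z]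
   of degree n (up to a nonzero scalar). *)
Definition curve_of_degree (n : nat) (F : {mpoly K[3]}) : Prop :=
  F != 0 /\ F \is n.-homog.

(* Irreducibility over K: F is non-constant and has no factorization into two
   non-constant polynomials (msize G <= 1 means G is constant). *)
Definition irreducible_mpoly (F : {mpoly K[3]}) : Prop :=
  (1 < msize F)%N /\
  forall G H : {mpoly K[3]}, F = G * H -> (msize G <= 1)%N \/ (msize H <= 1)%N.

Definition lin_subst (M : 'M[K]_3) (F : {mpoly K[3]}) : {mpoly K[3]} :=
  F \mPo [tuple (\sum_(j < 3) M i j *: 'X_j) | i < 3].

(* The image of the curve F = 0 under the projectivity x |-> M x is the curve
   F(M^-1 x) = 0; the curve is mapped onto itself iff this polynomial is a
   nonzero scalar multiple of F. *)
Definition curve_invariant (G : 'M[K]_3 -> Prop) (F : {mpoly K[3]}) : Prop :=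
  forall M, G M -> exists c : K, c != 0 /\ lin_subst (invmx M) F = c *: F.

Definition inv_irr_deg (G : 'M[K]_3 -> Prop) (n : nat) : Prop :=
  exists F : {mpoly K[3]},
    curve_of_degree n F /\ irreducible_mpoly F /\ curve_invariant G F.

Definition is_d (G : 'M[K]_3 -> Prop) (n : nat) : Prop :=
  [/\ n <> 1%N, inv_irr_deg G n &
      forall m : nat, m <> 1%N -> inv_irr_deg G m -> (n <= m)%N].

Definition is_dprime (G : 'M[K]_3 -> Prop) (n n' : nat) : Prop :=
  [/\ (n < n')%N, inv_irr_deg G n' &
      forall m : nat, (n < m)%N -> inv_irr_deg G m -> (n' <= m)%N].

Definition is_eps (G : 'M[K]_3 -> Prop) (e : nat) : Prop :=
  exists n n', [/\ is_d G n, is_dprime G n n' & e = (n' - n)%N].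

(* Points of PG(2,K) are nonzero column vectors up to nonzero scalars. *)
Definition proj_eq (u v : 'cV[K]_3) : Prop :=
  exists c : K, c != 0 /\ u = c *: v.

Definition vertex (i : 'I_3) : 'cV[K]_3 := delta_mx i 0.

(* Representatives in GL(3,q) of the elements of PGL(3,q), where F_q is the
   subfield {x | x^q = x} of K. *)
Definition in_PGL3q (q : nat) (M : 'M[K]_3) : Prop :=
  (forall i j, M i j ^+ q = M i j) /\ M \in unitmx.

Definition Delta (q : nat) (M : 'M[K]_3) : Prop :=
  [/\ in_PGL3q q M,
      forall i, exists j, proj_eq (M *m vertex i) (vertex j) &
      forall j, exists i, proj_eq (M *m vertex i) (vertex j)].

Definition fermat (q : nat) : {mpoly K[3]} :=
  'X_x0 ^+ q.-1 + 'X_x1 ^+ q.-1 + 'X_x2 ^+ q.-1.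

Definition degree2q2_family (q : nat) (lam : K) : {mpoly K[3]} :=
  lam *: fermat q ^+ 2 + ('X_x0 * 'X_x1) ^+ q.-1 + ('X_x1 * 'X_x2) ^+ q.-1
  + ('X_x2 * 'X_x0) ^+ q.-1.

End PlaneCurves.

Definition algebraic_over_prime_field (K : fieldType) (x : K) : Prop :=
  exists P : {poly K}, P != 0 /\ (forall i, exists n : nat, P`_i = n%:R) /\ root P x.

(* Main.v *)
Require Import Defs.
From HB Require Import structures.
From mathcomp Require Import all_boot all_order all_algebra.
From mathcomp Require Import perm separable cyclic cyclotomic ring.
From mathcomp Require Import mpoly.
Import Order.TTheory GRing.Theory.
Local Open Scope ring_scope.

(** Put m = q - 1.  The diagonal matrices over F_q multiply the monomials of an
    invariant form by a common scalar, so exponents of each variable agree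
    modulo m; unless they all vanish modulo m, that variable divides the form,
    which is then a line.  Hence an invariant irreducible form is a form in
    X^m, Y^m, Z^m, and the permutation matrices make its coefficients constant
    on orbits of monomials.  The Fermat form and the member lambda = 0 of the
    pencil (its image under the standard Cremona map) are irreducible by
    Eisenstein's criterion in Z at a linear factor X - zY of X^m + Y^m, which
    is simple because m is invertible in K. *)

(** * Eisenstein's criterion relative to a ring morphism *)

Lemma coef0_divisor_Xn (D : idomainType) (g h : {poly D}) n :
  g * h = 'X^n -> (size g <= n)%N -> h`_0 = 0.
Proof.
move=> gh sg; apply/eqP/negPn/negP => h0.
(* When the constant term of [h] is nonzero, the lowest nonzero term of [g] survives in the product;
   so [g] has none below degree [n], and the size bound leaves [g = 0]. *)
have g0 k : (k < n)%N -> g`_k = 0.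
  elim/ltn_ind: k => k IH kn.
  have : (g * h)`_k = 0 by rewrite gh coefXn ltn_eqF.
  rewrite coefM big_ord_recr /= subnn big1 ?add0r.
    by move/eqP; rewrite mulf_eq0 (negPf h0) orbF => /eqP.
  by move=> i _; rewrite IH ?mul0r // (ltn_trans _ kn).
have gE : g = 0.
  apply/polyP => k; rewrite coef0; case: (ltnP k n) => [/g0 //|nk].
  by rewrite nth_default // (leq_trans sg).
by have := @monic_neq0 _ 'X^n (monicXn D n); rewrite -gh gE mul0r eqxx.
Qed.

Section Eisenstein.
Variables (A B : idomainType) (e : {rmorphism A -> B}) (l : A).
Hypothesis kerP : forall a, e a = 0 -> exists b, a = b * l.
Variables G H : {poly A}.

(** The kernel of [e] plays the prime ideal: the target is a domain and kernel elements are
    multiples of [l]. If both factors had positive degree, their images, of product ['X^m], would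
    have size at most [m], so both constant terms would die under [e] and their product would be a
    multiple of [l ^+ 2]. *)
Lemma eisenstein m :
  map_poly e (G * H) = 'X^m -> size (G * H) = m.+1 ->
  (forall c, (G * H)`_0 <> c * l ^+ 2) -> (size G <= 1)%N \/ (size H <= 1)%N.
Proof.
move=> eGH sGH nl2.
case: (leqP (size G) 1); first by left.
case: (leqP (size H) 1); first by right.
move=> sH sG; exfalso.
have nzGH : G * H != 0 by rewrite -size_poly_gt0 sGH.
have [nzG nzH] : G != 0 /\ H != 0.
  by apply/andP; move: nzGH; rewrite mulf_eq0 negb_or.
move: sGH; rewrite size_mul // => sGH.
have szG : (size (map_poly e G) <= m)%N.
  apply: leq_trans (size_poly _ _) _; move: sGH sG sH.
  by case: (size H) => [|[|k]] //; rewrite !addnS /= => -[<-]; rewrite leq_addr.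
have szH : (size (map_poly e H) <= m)%N.
  apply: leq_trans (size_poly _ _) _; move: sGH sG sH.
  by case: (size G) => [|[|k]] //; rewrite !addSn /= => -[<-]; rewrite leq_addl.
rewrite rmorphM in eGH.
have H0 := coef0_divisor_Xn _ _ _ _ eGH szG.
rewrite mulrC in eGH.
have G0 := coef0_divisor_Xn _ _ _ _ eGH szH.
rewrite !coef_map in H0 G0.
have [b bE] := kerP _ H0.
have [c cE] := kerP _ G0.
by apply: (nl2 (c * b)); rewrite coefM big_ord_recl big_ord0 addr0 /= bE cE expr2 mulrACA.
Qed.

(* Eisenstein's criterion for the reciprocal polynomial *)
Lemma eisenstein_rev :
  size (map_poly e (G * H)) = 1%N ->
  (forall c, lead_coef (G * H) <> c * l ^+ 2) -> (size G <= 1)%N \/ (size H <= 1)%N.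
Proof.
move=> eGH nl2.
case: (leqP (size G) 1); first by left.
case: (leqP (size H) 1); first by right.
move=> sH sG; exfalso.
have : map_poly e G * map_poly e H != 0 by rewrite -rmorphM -size_poly_gt0 eGH.
rewrite mulf_eq0 negb_or -!size_poly_gt0 => /andP[eG eH].
move: eGH; rewrite rmorphM size_mul -?size_poly_gt0 // => sz.
(* The images multiply to a nonzero constant, so both are constant; a factor of positive degree then
   has its leading coefficient in the kernel of [e]. *)
have zlead (P : {poly A}) : (1 < size P)%N -> (size (map_poly e P) <= 1)%N ->
    exists b, lead_coef P = b * l.
  move=> sP seP; apply: kerP; rewrite lead_coefE -coef_map nth_default //.
  by rewrite (leq_trans seP) // -ltnS prednK // ltnW.
have [b bE] : exists b, lead_coef G = b * l.
  apply: zlead => //; move: sz eG eH.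
  case: (size _) => // k; case: (size _) => // j.
  by rewrite addSn addnS /= => -[/eqP]; rewrite addn_eq0 => /andP[/eqP->].
have [c cE] : exists b, lead_coef H = b * l.
  apply: zlead => //; move: sz eG eH.
  case: (size _) => // k; case: (size _) => // j.
  by rewrite addSn addnS /= => -[/eqP]; rewrite addn_eq0 => /andP[_ /eqP->].
by apply: (nl2 (b * c)); rewrite lead_coefM bE cE expr2 mulrACA.
Qed.

End Eisenstein.

(** * Simple linear factors, and factorizations of the two forms in Z *)

Lemma not_sqr_dvd_separable (R : idomainType) (f : {poly R}) (a : R) :
  f^`().[a] != 0 -> forall c, f <> c * ('X - a%:P) ^+ 2.
Proof.
move=> fa c E; have La : ('X - a%:P).[a] = 0 by rewrite hornerXsubC subrr.
move: fa; rewrite E expr2 derivM hornerD !hornerM La derivM hornerD !hornerM La.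
by rewrite !(mulr0, mul0r, addr0) eqxx.
Qed.

(** In characteristic p, q - 1 equals -1, because q = 0. *)
Lemma pred_pchar_power_neq0 (R : nzRingType) (p k q : nat) :
  p \in [pchar R] -> (0 < k)%N -> q = (p ^ k)%N -> q.-1%:R != 0 :> R.
Proof.
move=> pR k0 qE; have q0 : (0 < q)%N by rewrite qE expn_gt0 prime_gt0 ?(pcharf_prime pR).
have : q.-1%:R + 1 = 0 :> R.
  by rewrite natr1 prednK // qE natrX (pcharf0 pR) expr0n (gtn_eqF k0).
by apply: contra_eqN => /eqP ->; rewrite add0r oner_eq0.
Qed.

Section Factors.
Variables (K : closedFieldType) (m : nat).
Hypothesis m0 : m%:R != 0 :> K.

(** This is X^m + Y^m, with X the outer and Y the inner variable. *)
Local Notation fm := ('X^m + ('X^m)%:P : {poly {poly K}}).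

Let m_gt0 : (0 < m)%N.
Proof. by case: m m0 => //; rewrite eqxx. Qed.

(** Take z with z^m = -1. The derivative in X at zY is m (zY)^(m-1), nonzero because m is
    invertible, so X - zY is a simple factor. *)
Lemma exists_linear_factor : exists z : K,
  z != 0 /\ fm.[z *: 'X] = 0 /\
  forall c, fm <> c * ('X - (z *: 'X)%:P) ^+ 2.
Proof.
have [z /eqP] : exists x, root ('X^m + 1 : {poly K}) x.
  by apply/closed_rootP; rewrite -(polyC1) size_XnaddC // eqSS -lt0n.
rewrite !hornerE => /eqP; rewrite addr_eq0 => /eqP zm.
have z0 : z != 0.
  apply/eqP => z0; move/eqP: zm; rewrite z0 expr0n (gtn_eqF m_gt0) /=.
  by rewrite eq_sym oppr_eq0 oner_eq0.
exists z; split=> //; split.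
  by rewrite !hornerE exprZn zm scaleN1r addNr.
apply: not_sqr_dvd_separable.
rewrite derivD derivXn derivC addr0 hornerMn hornerXn -mulr_natr mulf_neq0 //.
  by rewrite expf_neq0 // scaler_eq0 (negPf z0) polyX_eq0.
by rewrite -polyC1 -polyCMn polyC_eq0.
Qed.

Lemma constant_unit (g : {poly {poly K}}) :
  g \is a GRing.unit -> exists c : K, g = c%:P%:P.
Proof.
rewrite poly_unitE => /andP[/eqP sg]; rewrite poly_unitE => /andP[/eqP sg0 _].
have /size_poly1P[a _ E] : size g == 1%N by rewrite sg.
have /size_poly1P[b _ E'] : size g`_0 == 1%N by rewrite sg0.
by exists b; rewrite -E' E coefC.
Qed.

(** A common divisor [g] of X^m + Y^m and (XY)^m divides X^(2m) and Y^(2m). The first makes its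
    leading coefficient in X a unit, the second makes it free of X; so [g] is a unit. *)
Lemma constant_common_divisor (g h1 h2 : {poly {poly K}}) :
  fm = g * h1 -> ('X * 'X%:P) ^+ m = g * h2 -> exists c : K, g = c%:P%:P.
Proof.
move=> E1 E2.
have X2 : 'X^m * 'X^m = g * (h1 * 'X^m - h2).
  by rewrite mulrBr mulrA -E1 -E2 mulrDl exprMn -rmorphXn /= (mulrC 'X^m _%:P) addrK.
have Y2 : ('X^m * 'X^m)%:P = g * (h1 * ('X^m)%:P - h2).
  by rewrite mulrBr mulrA -E1 -E2 mulrDl exprMn -rmorphXn /= rmorphM addrC addKr.
apply: constant_unit; rewrite poly_unitE.
have ulead : lead_coef g \is a GRing.unit.
  have : lead_coef ('X^m * 'X^m : {poly {poly K}}) = 1.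
    by rewrite -exprD lead_coefXn.
  by rewrite X2 lead_coefM => E; apply/unitrPr; eexists; exact: E.
have nzY : ('X^m * 'X^m)%:P != 0 :> {poly {poly K}}.
  by rewrite polyC_eq0 mulf_neq0 // expf_neq0 ?polyX_eq0.
have sg : size g = 1%N.
  move: nzY; rewrite Y2 mulf_eq0 negb_or => /andP[g0 h0].
  have := size_mul g0 h0; rewrite -Y2 size_polyC.
  rewrite mulf_neq0 ?expf_neq0 ?polyX_eq0 //=.
  move: g0 h0; rewrite -!size_poly_gt0; case: (size g) => // k _; case: (size _) => // j _.
  by rewrite addSn addnS /= => -[/esym/eqP]; rewrite addn_eq0 => /andP[/eqP->].
by rewrite sg eqxx /=; move: ulead; rewrite lead_coefE sg.
Qed.

(** Evaluation at X = zY has kernel generated by X - zY and sends the form to Z^m, so Eisenstein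
    makes one factor free of Z. The form being monic in Z, that factor is a unit. *)
Lemma fermat_factor (G H : {poly {poly {poly K}}}) :
  'X^m + fm%:P = G * H ->
  (exists c : K, G = c%:P%:P%:P) \/ (exists c : K, H = c%:P%:P%:P).
Proof.
move=> E.
have [z [z0 [fz nl2]]] := exists_linear_factor.
have lead1 : lead_coef (G * H) = 1 by rewrite -E lead_coefXnaddC.
have : (size G <= 1)%N \/ (size H <= 1)%N.
  apply: (@eisenstein _ _ (horner_eval (z *: 'X)) ('X - (z *: 'X)%:P) _ _ _ m).
  - by move=> a /eqP /factor_theorem.
  - rewrite -E rmorphD /= map_polyXn map_polyC /= /horner_eval fz addr0 //.
  - by rewrite -E size_XnaddC.
  - by rewrite -E coefD coefXn coefC /= (ltn_eqF m_gt0) add0r.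
move: lead1; rewrite lead_coefM => lead1.
case=> /size1_polyC EE; [left|right];
   move: lead1; rewrite EE lead_coefC => u.
  have [c ->] : exists c : K, G`_0 = c%:P%:P.
    by apply: constant_unit; apply/unitrPr; exists (lead_coef H).
  by exists c.
have [c ->] : exists c : K, H`_0 = c%:P%:P.
  by apply: constant_unit; apply/unitrPr; exists (lead_coef G); rewrite mulrC.
by exists c.
Qed.

(** Here X^m + Y^m is the leading coefficient in Z, and at X = zY the form reduces to the nonzero
    constant z^m Y^(2m), whence the reciprocal criterion. A factor free of Z divides both
    coefficients, which are coprime. *)
Lemma cremona_factor (G H : {poly {poly {poly K}}}) :
  fm%:P * 'X^m + (('X * 'X%:P) ^+ m)%:P = G * H ->
  (exists c : K, G = c%:P%:P%:P) \/ (exists c : K, H = c%:P%:P%:P).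
Proof.
move=> E.
have [z [z0 [fz nl2]]] := exists_linear_factor.
have fm0 : fm != 0.
  by apply/eqP => fm0; apply: (nl2 0); rewrite mul0r.
have c0 : (G * H)`_0 = ('X * 'X%:P) ^+ m.
  by rewrite -E coefD coefCM coefXn coefC /= (ltn_eqF m_gt0) mulr0 add0r.
have cm : (G * H)`_m = fm.
  by rewrite -E coefD coefCM coefXn coefC /= eqxx (gtn_eqF m_gt0) mulr1 addr0.
have leadE : lead_coef (G * H) = fm.
  have sz : size (fm%:P * 'X^m) = m.+1.
    by rewrite size_Cmul // size_polyXn.
  rewrite -E lead_coefDl ?sz; first by rewrite lead_coefM lead_coefXn lead_coefC mulr1.
  by apply: leq_ltn_trans (size_polyC_leq1 _) _.
have : (size G <= 1)%N \/ (size H <= 1)%N.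
  apply: (@eisenstein_rev _ _ (horner_eval (z *: 'X)) ('X - (z *: 'X)%:P)).
  - by move=> a /eqP /factor_theorem.
  - rewrite -E rmorphD rmorphM /= !map_polyC /= /horner_eval fz mul0r add0r.
    rewrite size_polyC horner_exp hornerM hornerX hornerC.
    rewrite expf_neq0 // mulf_neq0 ?polyX_eq0 //.
    by rewrite scaler_eq0 (negPf z0) polyX_eq0.
  - by rewrite leadE.
have cst (P Q : {poly {poly {poly K}}}) : (size P <= 1)%N -> P * Q = G * H ->
    exists c : K, P = c%:P%:P%:P.
  move=> /size1_polyC EE EPQ.
  have [c cE] : exists c : K, P`_0 = c%:P%:P.
    apply: (@constant_common_divisor _ Q`_m Q`_0).
      by rewrite -cm -EPQ EE coefCM coefC.
    by rewrite -c0 -EPQ EE coefCM coefC.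
  by exists c; rewrite EE cE.
by case=> s; [left; apply: (cst _ H)|right; apply: (cst _ G)] => //; rewrite mulrC.
Qed.

End Factors.

(** * Ternary polynomials as iterated univariate polynomials *)

Lemma ord3_cases (i : 'I_3) : i = x0 \/ i = x1 \/ i = x2.
Proof.
by case: i => [[|[|[|]]]] //= H; [left|right;left|right;right]; apply: val_inj.
Qed.

Section Nested.
Variable K : fieldType.
Local Notation P3 := {poly {poly {poly K}}}.

(* K[x1][x0][x2], with x2 outermost *)
Definition nested_var (i : 'I_3) : P3 := tnth [tuple ('X)%:P; ('X)%:P%:P; 'X] i.

Definition nested : {mpoly K[3]} -> P3 :=
  mmap (polyC \o (polyC \o polyC)) nested_var.

HB.instance Definition _ := GRing.RMorphism.on nested.

Let commr (R : nzRingType) (f : {rmorphism R -> {mpoly K[3]}}) i :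
  commr_rmorph f 'X_i.
Proof. by move=> x; apply: mulrC. Qed.

(** A left inverse of [nested] is built one variable at a time, from the innermost outwards. *)
Let unnest1 := horner_morph (commr _ (@mpolyC 3 K) x1).
Let unnest2 := horner_morph (commr _ unnest1 x0).

Definition unnest : P3 -> {mpoly K[3]} := horner_morph (commr _ unnest2 x2).

HB.instance Definition _ := GRing.RMorphism.on unnest.

Lemma unnestC c : unnest c%:P%:P%:P = c%:MP.
Proof.
by rewrite /unnest horner_morphC /= /unnest2 horner_morphC /= /unnest1 horner_morphC.
Qed.

Lemma nestedK G : unnest (nested G) = G.
Proof.
rewrite [in LHS](mpolyE G) (rmorph_sum nested) rmorph_sum [RHS]mpolyE; apply: eq_bigr => m _.
rewrite -mul_mpolyC !rmorphM /=; congr (_ * _).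
  by rewrite /nested mmapC /= unnestC.
rewrite /nested mmapX /mmap1 rmorph_prod mpolyXE_id; apply: eq_bigr => i _.
rewrite rmorphXn; congr (_ ^+ _).
have [->|[->|->]] := ord3_cases i.
- by rewrite /nested_var (tnth_nth 0) /= /unnest horner_morphC /= /unnest2 horner_morphX.
- by rewrite /nested_var (tnth_nth 0) /= /unnest horner_morphC /=
    /unnest2 horner_morphC /= /unnest1 horner_morphX.
- by rewrite /nested_var (tnth_nth 0) /= /unnest horner_morphX.
Qed.

(** Factorizations are carried along [nested], and [unnest] brings a constant factor back to a
    constant. *)
Lemma irreducible_nested F : (1 < msize F)%N ->
  (forall G H : P3, nested F = G * H ->
     (exists c : K, G = c%:P%:P%:P) \/ (exists c : K, H = c%:P%:P%:P)) ->
  irreducible_mpoly F.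
Proof.
move=> sF irr; split=> // G H E.
have cst P c : nested P = c%:P%:P%:P -> (msize P <= 1)%N.
  by move=> EP; rewrite -(nestedK P) EP unnestC msizeC; case: eqP.
have [|[c /cst]|[c /cst]] := irr (nested G) (nested H); [|by left|by right].
by rewrite E rmorphM.
Qed.

Lemma nestedX i : nested 'X_i = nested_var i.
Proof. by rewrite /nested mmapX mmap1U. Qed.

End Nested.

(** * Irreducibility of the Fermat form and of its Cremona image *)

Section Irreducibility.
Variables (K : closedFieldType) (q : nat).
Hypothesis m0 : q.-1%:R != 0 :> K.

Let m_gt0 : (0 < q.-1)%N.
Proof. by case: q.-1 m0 => //; rewrite eqxx. Qed.

Lemma irreducible_fermat : irreducible_mpoly (@fermat K q).
Proof.
apply: irreducible_nested.
  (* One monomial of positive degree with coefficient 1 shows that the form is not constant. *)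
  have F0 : (@fermat K q)@_(U_(x0) *+ q.-1) != 0.
    rewrite /fermat !mpolyXn !mcoeffD !mcoeffX eqxx.
    have h (i : 'I_3) : i != x0 ->
        ((U_(i) *+ q.-1)%MM == (U_(x0) *+ q.-1)%MM :> 'X_{1..3}) = false.
      move=> ix; apply/eqP => /mnmP/(_ i); rewrite !mulmnE !mnm1E eqxx.
      rewrite (eq_sym x0) (negPf ix) mul0n mul1n.
      by move=> E; move: m_gt0; rewrite E.
    by rewrite !h // !addr0 oner_eq0.
  have := @msize_mdeg_lt _ _ (@fermat K q) (U_(x0) *+ q.-1)%MM.
  rewrite mcoeff_msupp => /(_ F0); rewrite mdegMn mdeg1 mul1n.
  by apply: leq_ltn_trans.
move=> G H E; apply: (@fermat_factor K q.-1) => //; rewrite -E.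
rewrite /fermat !rmorphD !rmorphXn /= !nestedX /nested_var !(tnth_nth 0) /=.
by rewrite addrC.
Qed.

Lemma irreducible_cremona : irreducible_mpoly (@degree2q2_family K q 0).
Proof.
apply: irreducible_nested.
  have F0 : (@degree2q2_family K q 0)@_((U_(x0) + U_(x1)) *+ q.-1) != 0.
    rewrite /degree2q2_family scale0r add0r -!mpolyXD !mpolyXn !mcoeffD !mcoeffX eqxx.
    have h (i j : 'I_3) : (i == x2) || (j == x2) ->
        (((U_(i) + U_(j)) *+ q.-1)%MM ==
         ((U_(x0) + U_(x1)) *+ q.-1)%MM :> 'X_{1..3}) = false.
      move=> ix; apply/eqP => /mnmP/(_ x2); rewrite !mulmnE !mnmDE !mnm1E /=.
      move=> /eqP; rewrite muln_eq0 addn_eq0 !eqb0 (gtn_eqF m_gt0) orbF.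
      by case/orP: ix => ->; rewrite ?andbF.
    by rewrite !h // !addr0 oner_eq0.
  have := @msize_mdeg_lt _ _ (@degree2q2_family K q 0) ((U_(x0) + U_(x1)) *+ q.-1)%MM.
  rewrite mcoeff_msupp => /(_ F0); rewrite mdegMn mdegD !mdeg1.
  by apply: leq_ltn_trans; rewrite muln_gt0.
move=> G H E; apply: (@cremona_factor K q.-1) => //; rewrite -E.
rewrite /degree2q2_family scale0r add0r !rmorphD !rmorphXn !rmorphM /=.
rewrite !nestedX /nested_var !(tnth_nth 0) /=.
by rewrite !exprMn mulrDl [RHS]addrC [X in _ = _ + X]addrC [X in _ = X + _]mulrC addrA.
Qed.
End Irreducibility.

(** * Monomial substitutions and the elements of [Delta] *)

Definition monomial_subst (n : nat) (R : comNzRingType) (a : 'I_n -> R) (s : 'S_n)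
    (F : {mpoly R[n]}) : {mpoly R[n]} :=
  F \mPo [tuple a i *: 'X_(s i) | i < n].

(** The substitution permutes the monomials up to scalars, so exactly one exponent [m'], namely [m]
    composed with [s], contributes to the coefficient at [m]. *)
Lemma mcoeff_monomial_subst (n : nat) (R : comNzRingType) (a : 'I_n -> R) (s : 'S_n) F m :
  (monomial_subst n R a s F)@_m =
  F@_[multinom m (s i) | i < n] * \prod_i a i ^+ m (s i).
Proof.
rewrite /monomial_subst comp_mpolyE raddf_sum /=.
pose m' := [multinom m (s i) | i < n].
have term k : (F@_k *: \prod_(i < n) tnth [tuple a i *: 'X_(s i) | i < n] i ^+ k i)@_m
     = F@_k * ((\prod_i a i ^+ m (s i)) *+ (k == m')).
  rewrite mcoeffZ; congr (_ * _).
  rewrite (eq_bigr (fun i => a i ^+ k i *: 'X_(s i) ^+ k i)); last first.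
    by move=> i _; rewrite tnth_mktuple exprZn.
  rewrite scaler_prod mcoeffZ.
  have -> : \prod_(i < n) 'X_(s i) ^+ k i = 'X_[R, [multinom k ((s^-1)%g i) | i < n]].
    rewrite [RHS](mpolyXE _ s); apply: eq_bigr => i _.
    by rewrite mnmE permK.
  rewrite mcoeffX.
  have -> : ([multinom k ((s^-1)%g i) | i < n] == m) = (k == m').
    rewrite /m'; apply/eqP/eqP => [<-|->]; apply/mnmP => i; rewrite !mnmE ?permK //.
    by rewrite permKV.
  case: eqP => [->|_]; last by rewrite mulr0.
  by rewrite mulr1 mulr1n; apply: eq_bigr => i _; rewrite mnmE.
under eq_bigr do rewrite term.
case: (boolP (m' \in msupp F)) => [mF|mF].
  rewrite (bigD1_seq m') ?msupp_uniq //= eqxx mulr1n [X in _ + X]big1 ?addr0 //.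
  by move=> k /negPf ->; rewrite mulr0n mulr0.
rewrite (memN_msupp_eq0 mF) mul0r big_seq big1 // => k kF.
by case: eqP => [E|]; [move: mF; rewrite -E kF|rewrite mulr0n mulr0].
Qed.

Lemma expr_pred_eq1 (R : idomainType) (q : nat) (x : R) :
  (0 < q)%N -> x != 0 -> (x ^+ q == x) = (x ^+ q.-1 == 1).
Proof.
case: q => // q _ x0; rewrite exprS -subr_eq0 -[X in _ - X]mulr1 -mulrBr mulf_eq0.
by rewrite (negPf x0) /= subr_eq0.
Qed.

Lemma col_delta (R : pzSemiRingType) (m n : nat) (M : 'M[R]_(m, n)) i j :
  (M *m delta_mx j (0 : 'I_1)) i 0 = M i j.
Proof. by rewrite -colE mxE. Qed.

(** The inverse is prescribed because invariance is phrased with [invmx M]. The matrix [M] sends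
    vertex [i] to a multiple of vertex [s i]. *)
Lemma Delta_monomial (K : fieldType) (q : nat) (a : 'I_3 -> K) (s : 'S_3) :
  (1 < q)%N -> (forall i, a i ^+ q.-1 = 1) ->
  exists M, Delta q M /\ invmx M = \matrix_(i, j) (a i *+ (j == s i)).
Proof.
move=> q1 a1.
have q0 : (0 < q)%N by apply: ltnW.
have qm0 : (0 < q.-1)%N by case: q q1 {a1 q0} => [|[]].
have a0 i : a i != 0.
  by apply/eqP => a0; have /eqP := a1 i; rewrite a0 expr0n (gtn_eqF qm0) eq_sym oner_eq0.
have aq i : a i ^+ q = a i by apply/eqP; rewrite expr_pred_eq1 // a1.
pose M : 'M[K]_3 := \matrix_(i, j) ((a j)^-1 *+ (i == s j)).
pose N : 'M[K]_3 := \matrix_(i, j) (a i *+ (j == s i)).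
have NM : N *m M = 1%:M.
  apply/matrixP => i j; rewrite !mxE (bigD1 (s i)) //= big1 ?addr0.
    rewrite !mxE eqxx mulr1n (inj_eq perm_inj).
    by case: eqP => [->|]; rewrite ?mulr1n ?mulr0n ?mulr0 ?divff.
  by move=> k ks; rewrite !mxE (negPf ks) mulr0n mul0r.
have [_ uM] := mulmx1_unit NM.
have Mv i : M *m vertex K i = (a i)^-1 *: vertex K (s i).
  apply/matrixP => k l; rewrite ord1 col_delta !mxE andbT.
  by case: eqP; rewrite ?mulr1n ?mulr0n ?mulr1 ?mulr0.
exists M; split; last by rewrite -[LHS]mul1mx -NM mulmxK.
split.
- split=> // i j; rewrite mxE; case: eqP => _; last by rewrite mulr0n expr0n (gtn_eqF q0).
  by rewrite mulr1n exprVn aq.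
- by move=> i; exists (s i), (a i)^-1; rewrite invr_eq0.
- move=> j; exists ((s^-1)%g j), (a ((s^-1)%g j))^-1.
  by rewrite invr_eq0 a0 Mv permKV.
Qed.

(** Let [f j] be a vertex that [M] sends to vertex [j], with scalar [c j]. Then [f] is a
    permutation, [s] is its inverse, and [a] collects the inverses of the [c j], which are entries
    of [M] and so lie in the field of q elements. *)
Lemma invmx_Delta (K : fieldType) (q : nat) (M : 'M[K]_3) :
  (0 < q)%N -> Delta q M ->
  exists (a : 'I_3 -> K) (s : 'S_3), (forall i, a i ^+ q.-1 = 1) /\
    invmx M = \matrix_(i, j) (a i *+ (j == s i)).
Proof.
move=> q0 [[Mq uM] _ /fin_all_exists[f /fin_all_exists[c fc]]].
have c0 j : c j != 0 by case: (fc j).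
have Mf j : M *m vertex K (f j) = c j *: vertex K j by case: (fc j).
have cE j : c j = M j (f j).
  by rewrite -col_delta (Mf j) !mxE !eqxx mulr1.
(* If [f i = f j] with [i] and [j] distinct, coordinate [i] of the common image is both [c i] and
   0. *)
have finj : injective f.
  move=> i j fij; apply/eqP; have := c0 i; apply: contraNT => ij.
  have := congr1 (fun A : 'cV_3 => A i 0) (Mf i).
  by rewrite fij Mf !mxE !eqxx (negPf ij) mulr0 mulr1 => <-.
have Nv j : invmx M *m vertex K j = (c j)^-1 *: vertex K (f j).
  rewrite -[RHS]mul1mx -(mulVmx uM) -mulmxA -scalemxAr Mf scalerA mulVf //.
  by rewrite scale1r.
exists (fun i => (c (((perm finj)^-1)%g i))^-1), ((perm finj)^-1)%g; split.
  move=> i; rewrite exprVn; apply/eqP; rewrite invr_eq1 -expr_pred_eq1 //.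
  by rewrite cE Mq.
apply/matrixP => i j; rewrite -col_delta [_ *m _](Nv j) !mxE andbT.
have -> : (j == ((perm finj)^-1)%g i) = (i == f j).
  by rewrite -(inj_eq (@perm_inj _ (perm finj))) permKV permE eq_sym.
case: eqP => [->|_]; last by rewrite mulr0 mulr0n.
by rewrite mulr1 mulr1n -(permE finj) permK.
Qed.

Lemma lin_subst_monomial (K : fieldType) (a : 'I_3 -> K) (s : 'S_3) F :
  lin_subst (\matrix_(i, j) (a i *+ (j == s i))) F = monomial_subst 3 K a s F.
Proof.
congr (F \mPo _); apply/eq_from_tnth => i; rewrite !tnth_mktuple.
rewrite (bigD1 (s i)) //= big1 ?addr0 ?mxE ?eqxx // => j ji.
by rewrite mxE (negPf ji) scale0r.
Qed.

(** The inverses of the elements of [Delta] are exactly the monomial matrices whose nonzero entries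
    are (q-1)-th roots of unity. *)
Lemma curve_invariant_DeltaP (K : fieldType) (q : nat) F : (1 < q)%N ->
  curve_invariant (@Delta K q) F <->
  forall (a : 'I_3 -> K) (s : 'S_3), (forall i, a i ^+ q.-1 = 1) ->
    exists c, c != 0 /\ monomial_subst 3 K a s F = c *: F.
Proof.
move=> q1; split=> [inv a s a1|inv M /(invmx_Delta K q M (ltnW q1))[a [s [a1 ->]]]].
  have [M [/inv + ME]] := Delta_monomial K q a s q1 a1.
  by rewrite ME lin_subst_monomial.
by rewrite lin_subst_monomial; apply: inv.
Qed.

(** * Constraints of invariance on coefficients and exponents *)

Section Coefficients.
Variables (K : fieldType) (q : nat) (F : {mpoly K[3]}).
Hypotheses (q1 : (1 < q)%N) (inv : curve_invariant (@Delta K q) F).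

Lemma mcoeff_perm_invariant (s : 'S_3) : exists c : K, c != 0 /\
  forall m : 'X_{1..3}, F@_[multinom m (s i) | i < 3] = c * F@_m.
Proof.
have /(curve_invariant_DeltaP K q F q1) invP := inv.
have [i|c [c0 E]] := invP (fun=> 1) s; first by rewrite expr1n.
exists c; split=> // m; move: (congr1 (mcoeff m) E).
rewrite mcoeff_monomial_subst mcoeffZ big1 ?mulr1 // => i _.
by rewrite expr1n.
Qed.

Lemma msupp_mod_invariant (g : K) m m' i : q.-1.-primitive_root g ->
  m \in msupp F -> m' \in msupp F -> m i = m' i %[mod q.-1].
Proof.
move=> gP mF m'F; apply/eqP; rewrite -(eq_prim_root_expr gP).
have /(curve_invariant_DeltaP K q F q1) invP := inv.
(* The diagonal matrix with [g] at place [i] scales a monomial [k] by [g ^+ k i]; on the support all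
   these scalars equal the single [c]. *)
pose a j := if j == i then g else 1.
have [j|c [c0 E]] := invP a 1%g.
  by rewrite /a; case: eqP => _; rewrite ?expr1n // prim_expr_order.
have key k : k \in msupp F -> g ^+ k i = c.
  rewrite mcoeff_msupp => Fk; move: (congr1 (mcoeff k) E).
  rewrite mcoeff_monomial_subst mcoeffZ (bigD1 i) //= big1 ?mulr1.
    rewrite perm1 /a eqxx.
    have -> : [multinom k ((1%g : 'S_3) i0) | i0 < 3] = k.
      by apply/mnmP => j; rewrite mnmE perm1.
    by rewrite mulrC => /(mulIf Fk).
  by move=> j /negPf ji; rewrite /a ji expr1n.
by rewrite !key.
Qed.

End Coefficients.

(** * Orbits, roots of unity and monomials *)

Lemma orbit_const (K : idomainType) (T : finType) (f : T -> K) :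
  (2 < #|T|)%N ->
  (forall s : {perm T}, exists c : K, c != 0 /\ forall i, f (s i) = c * f i) ->
  forall i j, f i = f j.
Proof.
move=> T3 H i j; have [->//|ij] := eqVneq i j.
(* A third point excludes the sign character: the transposition of [i] and [j] fixes [k], so its
   scalar is 1 when [f k] is nonzero. When [f k = 0], transpositions with [k] force [f = 0]. *)
have [k] : exists k, k \notin [set i; j].
  have : [set i; j] \proper [set: T].
    by rewrite properEcard subsetT cards2 cardsT ij.
  by case/properP => _ [k _ kij]; exists k.
rewrite !inE negb_or => /andP[ki kj].
have [fk|fk] := eqVneq (f k) 0.
  have z l : f l = 0.
    by have [c [_ E]] := H (tperm k l); rewrite -[l](tpermL k) E fk mulr0.
  by rewrite !z.
have [c [_ E]] := H (tperm i j).
have := E k; rewrite tpermD 1?eq_sym // -[LHS]mul1r => /(mulIf fk) c1.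
by have := E j; rewrite tpermR -c1 mul1r.
Qed.

(** As n is invertible, X^n - 1 is separable and has n distinct roots; n distinct n-th roots of
    unity in a field include a primitive one. *)
Lemma closed_field_prim_root (K : closedFieldType) n :
  n%:R != 0 :> K -> exists g : K, n.-primitive_root g.
Proof.
move=> n0; have n_gt0 : (0 < n)%N by case: n n0 => //; rewrite eqxx.
have [r] := closed_field_poly_normal ('X^n - 1 : {poly K}).
rewrite -[1]polyC1 lead_coefXnsubC // scale1r => rE.
have ur : uniq r.
  by rewrite -separable_prod_XsubC -rE polyC1 cyclotomic.separable_Xn_sub_1.
have sr : size r = n.
  by apply/eqP; rewrite -eqSS -(size_prod_XsubC r id) -rE size_XnsubC.
have /hasP[g _ gP] : has n.-primitive_root r.
  apply: has_prim_root => //; last by rewrite sr.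
  apply/allP => x xr; rewrite unity_rootE -subr_eq0.
  have : root ('X^n - 1%:P) x by rewrite rE root_prod_XsubC.
  by rewrite /root !hornerE.
by exists g.
Qed.

Lemma mpolyX_factor (n : nat) (R : comNzRingType) (F : {mpoly R[n]}) i :
  {in msupp F, forall m, (0 < (m : 'X_{1..n}) i)%N} -> exists H, F = 'X_i * H.
Proof.
move=> Fi; exists (\sum_(m <- msupp F) F@_m *: 'X_[m - U_(i)]).
rewrite mulr_sumr [LHS]mpolyE !big_seq; apply: eq_bigr => m mF.
rewrite -scalerAr -mpolyXD; congr (_ *: 'X_[_]).
apply/mnmP => j; rewrite mnmDE mnmBE mnm1E.
by case: eqP => [<-|_]; rewrite ?subn0 // subnKC // Fi.
Qed.

Lemma mpoly_injective_family (n : nat) (R : nzRingType) (I : finType)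
    (u : I -> 'X_{1..n}) (F : {mpoly R[n]}) : injective u ->
  {in msupp F, forall m, exists i, m = u i} ->
  F = \sum_i F@_(u i) *: 'X_[u i].
Proof.
move=> uinj Fu; apply/mpolyP => m; rewrite raddf_sum /=.
under eq_bigr do rewrite mcoeffZ mcoeffX.
have [/Fu[i ->]|mF] := boolP (m \in msupp F).
  rewrite (bigD1 i) //= eqxx mulr1 big1 ?addr0 // => j ji.
  by rewrite (inj_eq uinj) (negPf ji) mulr0.
rewrite (memN_msupp_eq0 mF) big1 // => i _.
case: eqP => [um|_]; last by rewrite mulr0.
by rewrite um (memN_msupp_eq0 mF) mul0r.
Qed.

Lemma big_ord3 (R : Type) (idx : R) (op : Monoid.law idx) (E : 'I_3 -> R) :
  \big[op/idx]_(i < 3) E i = op (op (E x0) (E x1)) (E x2).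
Proof.
rewrite !big_ord_recl big_ord0 Monoid.mulm1 Monoid.mulmA.
by congr (op (op (E _) (E _)) (E _)); apply: val_inj.
Qed.

(** Mixed monomials are indexed by the missing variable, so that both families are indexed by ['I_3]
    and [orbit_const] applies to each. *)
Lemma mdeg3_eq2 (e : 'X_{1..3}) : mdeg e = 2%N ->
  (exists i, e = (U_(i) *+ 2)%MM) \/
  (exists i, e = [multinom (k != i : nat) | k < 3]).
Proof.
rewrite mdegE big_ord3 /= => E.
have ext (e' : 'X_{1..3}) : e x0 = e' x0 -> e x1 = e' x1 -> e x2 = e' x2 -> e = e'.
  move=> e0 e1 e2; apply/mnmP => i.
  by have [->|[->|->]] := ord3_cases i.
move: E (ext); move: (e x0) (e x1) (e x2) => [|[|[|?]]] [|[|[|?]]] [|[|[|?]]] // _ {}ext;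
 solve [ left; exists x0; apply: ext; rewrite ?mulmnE ?mnm1E //
       | left; exists x1; apply: ext; rewrite ?mulmnE ?mnm1E //
       | left; exists x2; apply: ext; rewrite ?mulmnE ?mnm1E //
       | right; exists x0; apply: ext; rewrite mnmE //
       | right; exists x1; apply: ext; rewrite mnmE //
       | right; exists x2; apply: ext; rewrite mnmE //].
Qed.

(** * Invariance of the Fermat form and of the pencil *)

Section InvariantForms.
Variables (K : fieldType) (q : nat).
Hypothesis q1 : (1 < q)%N.

Let m_gt0 : (0 < q.-1)%N.
Proof. by case: q q1 => [|[]]. Qed.

(** The second elementary symmetric polynomial in X^m, Y^m, Z^m; indexing by the omitted variable
    gives its invariance by reindexing. *)
Definition pair_form : {mpoly K[3]} := \sum_(i < 3) \prod_(j < 3 | j != i) 'X_j ^+ q.-1.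

Lemma fermatE : @fermat K q = \sum_(i < 3) 'X_i ^+ q.-1.
Proof. by rewrite big_ord3. Qed.

Lemma pair_form_expand : pair_form =
  'X_x1 ^+ q.-1 * 'X_x2 ^+ q.-1 + 'X_x0 ^+ q.-1 * 'X_x2 ^+ q.-1
  + 'X_x0 ^+ q.-1 * 'X_x1 ^+ q.-1.
Proof.
rewrite /pair_form big_ord3.
by rewrite ![\prod_(j < 3 | _) _]big_mkcond !big_ord3 /= !mul1r !mulr1.
Qed.

Lemma degree2q2_familyE lam :
  @degree2q2_family K q lam = lam *: fermat K q ^+ 2 + pair_form.
Proof.
rewrite /degree2q2_family pair_form_expand -!addrA -!exprMn; congr (_ + _).
by rewrite [X in _ = X]addrA [RHS]addrC [in LHS](mulrC 'X_x2).
Qed.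

Lemma pair_formE :
  pair_form = \sum_(i < 3) 'X_[[multinom q.-1 * (k != i) | k < 3]%N].
Proof.
apply: eq_bigr => i _; rewrite mpolyXE_id big_mkcond; apply: eq_bigr => j _.
by rewrite mnmE; case: (j != i); rewrite ?muln1 // muln0 expr0.
Qed.

(** Newton's identity p_2 = e_1^2 - 2 e_2, valid in every characteristic; it expresses the orbit sum
    of pure powers through the generators of the pencil. *)
Lemma power_sum2 :
  \sum_(i < 3) 'X_[U_(i) *+ (2 * q.-1)] = fermat K q ^+ 2 - 2 *: pair_form.
Proof.
have sq (R : comPzRingType) (x y z : R) :
  x ^+ 2 + y ^+ 2 + z ^+ 2 = (x + y + z) ^+ 2 - (y * z + x * z + x * y) *+ 2.
  by ring.
rewrite scaler_nat big_ord3 /= mulnC -!mpolyXn !exprM /fermat.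
by rewrite pair_form_expand -sq.
Qed.

Section Subst.
Variables (a : 'I_3 -> K) (s : 'S_3).
Hypothesis a1 : forall i, a i ^+ q.-1 = 1.

Let substXn i :
  ('X_i ^+ q.-1) \mPo [tuple a i *: 'X_(s i) | i < 3] =
  'X_(s i) ^+ q.-1 :> {mpoly K[3]}.
Proof. by rewrite rmorphXn /= comp_mpolyXU -tnth_nth tnth_mktuple exprZn a1 scale1r. Qed.

Lemma monomial_subst_fermat : monomial_subst 3 K a s (fermat K q) = fermat K q.
Proof.
rewrite fermatE /monomial_subst rmorph_sum /= [RHS](reindex_inj (@perm_inj _ s)).
by apply: eq_bigr => i _; rewrite substXn.
Qed.

Lemma monomial_subst_pair_form : monomial_subst 3 K a s pair_form = pair_form.
Proof.
rewrite /pair_form /monomial_subst rmorph_sum /= [RHS](reindex_inj (@perm_inj _ s)).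
apply: eq_bigr => i _; rewrite rmorph_prod /= [RHS](reindex_inj (@perm_inj _ s)).
by apply: eq_big => [j|j _]; rewrite ?(inj_eq perm_inj) ?substXn.
Qed.

End Subst.

Lemma fermat_invariant : curve_invariant (@Delta K q) (fermat K q).
Proof.
apply/(curve_invariant_DeltaP K q _ q1) => a s a1; exists 1.
by rewrite oner_neq0 scale1r monomial_subst_fermat.
Qed.

Lemma degree2q2_family_invariant c lam :
  curve_invariant (@Delta K q) (c *: degree2q2_family q lam).
Proof.
apply/(curve_invariant_DeltaP K q _ q1) => a s a1; exists 1.
rewrite oner_neq0 scale1r degree2q2_familyE /monomial_subst.
rewrite linearZ linearD linearZ rmorphXn /=.
by rewrite -!/(monomial_subst 3 K a s _) monomial_subst_fermat
  ?monomial_subst_pair_form.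
Qed.

Lemma fermat_homog : @fermat K q \is q.-1.-homog.
Proof. by rewrite /fermat !mpolyXn !rpredD // dhomogX /= mdegMn mdeg1 mul1n. Qed.

Lemma degree2q2_family_homog lam :
  @degree2q2_family K q lam \is (2 * q.-1).-homog.
Proof.
rewrite /degree2q2_family -!mpolyXD !mpolyXn !rpredD ?dhomogX ?rpredZ //=.
- by rewrite mulnC dhomogMn // fermat_homog.
all: by rewrite mdegMn mdegD !mdeg1.
Qed.

End InvariantForms.

(** * Classification of invariant irreducible forms in degrees m and 2m *)

Section Classification.
Variables (K : closedFieldType) (q n : nat) (F : {mpoly K[3]}).
Hypotheses (q1 : (1 < q)%N) (m0 : q.-1%:R != 0 :> K).
Hypotheses (inv : curve_invariant (@Delta K q) F) (irrF : irreducible_mpoly F).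
Hypotheses (homF : F \is n.-homog) (n1 : n <> 1%N).

Let m_gt0 : (0 < q.-1)%N.
Proof. by case: q q1 => [|[]]. Qed.

Let F0 : F != 0.
Proof. by case: irrF => + _; apply: contraTneq => ->; rewrite mmeasure0. Qed.

Lemma msupp_dvd_invariant k i : k \in msupp F -> (q.-1 %| k i)%N.
Proof.
move=> kF; apply/negPn/negP => ndvd; apply: n1.
have [g gP] := closed_field_prim_root _ _ m0.
(* Every exponent of ['X_i] in the support is congruent to [k i], hence nonzero, so ['X_i] divides
   [F]. *)
have [|H E] := mpolyX_factor 3 K F i.
  move=> m mF; rewrite lt0n; apply: contraNneq ndvd => mi.
  by rewrite /dvdn (msupp_mod_invariant K q F q1 inv g k m i gP kF mF) mi mod0n.
case: irrF => _ /(_ _ _ E) [|/msize1_polyC HE].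
  by rewrite msizeX mdeg1.
have nzH : H@_0 != 0.
  by apply: contraNneq F0 => z; rewrite E HE z mulr0.
have homE : F \is 1.-homog.
  by rewrite E HE mulrC mul_mpolyC rpredZ // dhomogX /= mdeg1.
exact: dhomog_uniq F0 homF homE.
Qed.

Lemma msupp_quotient k : k \in msupp F ->
  exists2 e : 'X_{1..3}, k = (e *+ q.-1)%MM & (mdeg e * q.-1)%N = n.
Proof.
move=> kF; pose e := [multinom (k i %/ q.-1)%N | i < 3].
have kE : k = (e *+ q.-1)%MM.
  by apply/mnmP => i; rewrite mulmnE mnmE divnK // msupp_dvd_invariant.
by exists e => //; rewrite -mdegMn -kE; apply: (dhomogP _ _ _ homF).
Qed.

Lemma invariant_degree : exists2 d, (0 < d)%N & n = (d * q.-1)%N.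
Proof.
have /hasP[k kF _] : has predT (msupp F).
  by rewrite has_predT lt0n size_eq0 msupp_eq0.
have [e _ nE] := msupp_quotient _ kF; exists (mdeg e); last by rewrite nE.
have n_gt0 : (0 < n)%N.
  have := irrF.1; rewrite (dhomog_uniq F0 homF (dhomog_msize homF)).
  by case: (msize F) => [|[]].
by move: n_gt0; rewrite -nE muln_gt0 => /andP[].
Qed.

Lemma mcoeff_power_const d i j : F@_(U_(i) *+ d) = F@_(U_(j) *+ d).
Proof.
apply: (@orbit_const K _ (fun i => F@_(U_(i) *+ d))); first by rewrite card_ord.
(* Composing exponents with the inverse of [s] moves the pure power of variable [k] to that of
   variable [s k]. *)
move=> s; have [c [c0 E]] := mcoeff_perm_invariant K q F q1 inv (s^-1)%g.
exists c; split=> // k; rewrite -E; congr (F@_ _); apply/mnmP => l.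
by rewrite mnmE !mulmnE !mnm1E (canF_eq (permK s)).
Qed.

Lemma mcoeff_pair_const d i j :
  F@_[multinom d * (k != i) | k < 3]%N = F@_[multinom d * (k != j) | k < 3]%N.
Proof.
apply: (@orbit_const K _ (fun i => F@_[multinom d * (k != i) | k < 3]%N));
  first by rewrite card_ord.
move=> s; have [c [c0 E]] := mcoeff_perm_invariant K q F q1 inv (s^-1)%g.
exists c; split=> // k; rewrite -E; congr (F@_ _); apply/mnmP => l.
by rewrite !mnmE -(canF_eq (permKV s)).
Qed.

(** Dividing exponents by m leaves degree 1, so only X^m, Y^m, Z^m occur, with equal
    coefficients. *)
Lemma invariant_degree_q1 : n = q.-1 -> exists c : K, c != 0 /\ F = c *: fermat K q.
Proof.
move=> nE; pose u (i : 'I_3) := (U_(i) *+ q.-1)%MM.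
have uinj : injective u.
  move=> i j /mnmP/(_ j)/eqP; rewrite !mulmnE eqn_pmul2r // !mnm1E eqxx.
  by rewrite eqb1 => /eqP.
have Fu : {in msupp F, forall m, exists i, m = u i}.
  move=> m mF; have [e mE] := msupp_quotient _ mF.
  rewrite nE -[X in _ = X]mul1n => /eqP; rewrite eqn_pmul2r // => /mdeg1P[i /eqP ei].
  by exists i; rewrite mE ei.
have FE : F = F@_(u x0) *: fermat K q.
  rewrite fermatE scaler_sumr [LHS](mpoly_injective_family 3 K _ u F uinj Fu).
  by apply: eq_bigr => i _; rewrite mpolyXn (mcoeff_power_const _ i x0).
exists (F@_(u x0)); split=> //.
by apply: contraNneq F0 => z; rewrite FE z scale0r.
Qed.

(** Dividing exponents by m leaves degree 2, hence two orbits of monomials and two free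
    coefficients. Newton's identity turns the orbit sums into the square of the Fermat form and
    [pair_form]. *)
Lemma invariant_degree_2q2 : irreducible_mpoly (fermat K q) -> n = (2 * q.-1)%N ->
  exists lam c : K, c != 0 /\ F = c *: degree2q2_family q lam.
Proof.
move=> irrf nE.
pose u (i : 'I_3 + 'I_3) : 'X_{1..3} :=
  match i with inl i => (U_(i) *+ (2 * q.-1))%MM
             | inr i => [multinom q.-1 * (k != i) | k < 3]%N end.
have uinj : injective u.
  have sep i j : u (inl i) <> u (inr j).
    move=> /mnmP/(_ i)/eqP; rewrite mulmnE mnm1E mnmE eqxx mul1n mulnC.
    by rewrite eqn_pmul2l //; case: (i != j).
  case=> [i|i] [j|j].
  - move=> /mnmP/(_ j)/eqP; rewrite !mulmnE eqn_pmul2r ?muln_gt0 //.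
    by rewrite !mnm1E eqxx eqb1 => /eqP ->.
  - by move/sep.
  - by move/esym/sep.
  - move=> /mnmP/(_ i)/eqP; rewrite !mnmE eqxx muln0 eq_sym muln_eq0.
    by rewrite (gtn_eqF m_gt0) /= eqb0 negbK => /eqP ->.
have Fu : {in msupp F, forall m, exists i, m = u i}.
  move=> m mF; have [e mE] := msupp_quotient _ mF.
  rewrite nE => /eqP; rewrite eqn_pmul2r // => /eqP /mdeg3_eq2[[i ei]|[i ei]].
    by exists (inl i); apply/mnmP => k; rewrite mE ei !mulmnE !mnm1E mulnA.
  by exists (inr i); apply/mnmP => k; rewrite mE ei !mulmnE !mnmE mulnC.
have FE : F = F@_(u (inl x0)) *: (fermat K q ^+ 2 - 2 *: pair_form K q) +
    F@_(u (inr x0)) *: pair_form K q.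
  rewrite [LHS](mpoly_injective_family 3 K _ u F uinj Fu) big_sumType /=.
  congr (_ + _).
    rewrite -power_sum2 scaler_sumr; apply: eq_bigr => i _.
    by rewrite (mcoeff_power_const _ i x0).
  rewrite pair_formE scaler_sumr; apply: eq_bigr => i _.
  by rewrite (mcoeff_pair_const _ i x0).
have sqE : F = F@_(u (inl x0)) *: fermat K q ^+ 2 +
    (F@_(u (inr x0)) - 2 * F@_(u (inl x0))) *: pair_form K q.
  rewrite [LHS]FE scalerBr scalerA scalerBl mulrC -!addrA; congr (_ + _).
  by rewrite addrC.
move: sqE; set al := F@_(u (inl _)); set be := _ - _ => sqE.
(* If [be] vanished, [F] would be a multiple of the square of the Fermat form, hence reducible. *)
have be0 : be != 0.
  apply/eqP => be0; move: sqE; rewrite be0 scale0r addr0 expr2 scalerAl => FF.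
  have [_ /(_ _ _ FF)] := irrF; have [sf _] := irrf.
  have al0 : al != 0 by apply: contraNneq F0 => z; rewrite FF z scale0r mul0r.
  by rewrite msizeZ // => -[]; rewrite leqNgt sf.
exists (al / be), be; split=> //.
by rewrite degree2q2_familyE scalerDr scalerA mulrCA mulfV // mulr1.
Qed.

End Classification.

Theorem mainTheorem12 (K : closedFieldType) (p k q : nat) :
  prime p -> p \in [pchar K] ->
  (forall x : K, algebraic_over_prime_field x) ->
  (0 < k)%N -> q = (p ^ k)%N -> (2 < q)%N ->
  [/\ is_d (@Delta K q) q.-1,
      is_eps (@Delta K q) q.-1,
      (curve_invariant (@Delta K q) (@fermat K q) /\
       irreducible_mpoly (@fermat K q) /\
       forall F : {mpoly K[3]},
         curve_of_degree q.-1 F -> irreducible_mpoly F ->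
         curve_invariant (@Delta K q) F ->
         exists c : K, c != 0 /\ F = c *: @fermat K q) &
      forall F : {mpoly K[3]}, curve_of_degree (2 * q.-1) F ->
        (irreducible_mpoly F /\ curve_invariant (@Delta K q) F) <->
        (irreducible_mpoly F /\
         exists lam c : K, c != 0 /\ F = c *: @degree2q2_family K q lam)].
Proof.
move=> _ pK _ k0 qE q2.
have q1 : (1 < q)%N by apply: ltnW.
(* This is where q > 2 enters: the Fermat form is not a line. *)
have m1 : (1 < q.-1)%N by rewrite -ltnS prednK // ltnW.
have m0 := pred_pchar_power_neq0 K p k q pK k0 qE.
have irrf := irreducible_fermat K q m0.
have irrc := irreducible_cremona K q m0.
have neq0 F : irreducible_mpoly F -> F != 0 :> {mpoly K[3]}.
  by case=> + _; apply: contraTneq => ->; rewrite mmeasure0.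
have inv_deg n : n <> 1%N -> inv_irr_deg (@Delta K q) n ->
    exists2 d, (0 < d)%N & n = (d * q.-1)%N.
  move=> n1 [F [[_ homF] [irrF inv]]].
  exact: invariant_degree homF n1.
have deg1 : inv_irr_deg (@Delta K q) q.-1.
  exists (fermat K q); split; last by split=> //; apply: fermat_invariant.
  by split; [apply: neq0|apply: fermat_homog].
have deg2 : inv_irr_deg (@Delta K q) (2 * q.-1).
  (* The member at parameter 0 is the Cremona image, already known to be irreducible. *)
  exists (degree2q2_family q 0); split; last first.
    split=> //; rewrite -[X in curve_invariant _ X]scale1r.
    by apply: degree2q2_family_invariant.
  by split; [apply: neq0|apply: degree2q2_family_homog].
have m_ne1 : q.-1 <> 1%N by move=> E; rewrite E in m1.
have dP : is_d (@Delta K q) q.-1.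
  split=> // n n1 /(inv_deg n n1)[d d0 ->].
  by rewrite leq_pmull.
split=> //.
- exists q.-1, (2 * q.-1)%N; split=> //; last by rewrite mul2n -addnn addnK.
  split=> //; first by rewrite ltn_Pmull // ltnW.
  (* [is_dprime] does not exclude lines, but a degree above m exceeds 1; it is therefore a multiple
     [d * q.-1] with [d] at least 2. *)
  move=> n mn /inv_deg [|d d0 nE].
    by move=> n1; move: mn; rewrite n1 ltnNge ltnW.
  by move: mn; rewrite nE -[X in (X < _)%N]mul1n !leq_pmul2r ?ltn_pmul2r // ltnW.
- split; first exact: fermat_invariant.
  split=> // F [_ homF] irrF inv.
  exact: (invariant_degree_q1 _ _ _ _ q1 m0 inv irrF homF m_ne1).
- move=> F [_ homF]; split=> [[irrF inv]|[irrF [lam [c [_ FE]]]]]; split=> //.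
    apply: (invariant_degree_2q2 _ _ _ _ q1 m0 inv irrF homF) => //.
    by move=> E; move: m1; rewrite ltnNge -[X in (_ <= X)%N]E leq_pmull.
  by rewrite FE; apply: degree2q2_family_invariant.
Qed.
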